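(* For every fixed absolutely continuous curve $\gamma:(a,b)\to U^\circ$: (i) if $L_g(\gamma)<\infty$, then $L_{g_N}(\gamma)<\infty$ for every $N$ and $L_{g_N}(\gamma)\to L_g(\gamma)$ as $N\to\infty$; (ii) if $L_{g_N}(\gamma)=\infty$ for some $N$, then $L_g(\gamma)=\infty$. Moreover, (iii) it is possible that $L_{g_N}(\gamma)<\infty$ for every $N$ but $L_g(\gamma)=\infty$: there exist exponents $(\alpha_j)$, weights $(c_j)$ as in the context, and a curve $\gamma$ with this property. Consequently, adding positive Newton terms can destroy finiteness of the length of a prescribed curve, but cannot create it.
   Context: Let $k\ge0$, let $V\subset\mathbb R^k$ be open, let $\varepsilon>0$, and let $U=[0,\varepsilon)^2\times V$ with coordinates $(x,y,z)$, $U^\circ=(0,\varepsilon)^2\times V$. Let $g_{\mathrm E}$ be the Euclidean metric and $g_0$ a smooth Riemannian metric on $U$ with $c_0g_{\mathrm E}\le g_0\le C_0g_{\mathrm E}$ for constants $0<c_0\le C_0<\infty$. Let $\alpha_j=(a_j,b_j)$, $j\ge1$, be points of a fixed compact subset of $\mathbb R_{\ge0}^2$, and let $c_j>0$ with $\sum_{j\ge1}c_j<\infty$. Put $\mu=\sum_{j\ge1}c_j\delta_{\alpha_j}$, $F(x,y)=\sum_{j=1}^\infty c_jx^{-a_j}y^{-b_j}$, $F_N(x,y)=\sum_{j=1}^Nc_jx^{-a_j}y^{-b_j}$, $g=Fg_0$ and $g_N=F_Ng_0$ on $U^\circ$. $L_g$ and $L_{g_N}$ denote lengths with respect to these metrics.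 *)

(* Defs.v *)
(* MathComp-Analysis, over an arbitrary [R : realType]. *)
From HB Require Import structures.
From mathcomp Require Export all_boot all_order all_algebra.
From mathcomp Require Export all_classical all_reals all_analysis.

Set Implicit Arguments.
Unset Strict Implicit.
Unset Printing Implicit Defensive.

Export Order.TTheory GRing.Theory Num.Theory.
Export numFieldNormedType.Exports.

Local Open Scope classical_set_scope.
Local Open Scope ring_scope.

(* The space R^2 x R^k is ['rV[R]_(2 + k)]. *)
Definition xcoord (R : realType) (k : nat) (p : 'rV[R]_(2 + k)) : R :=
  lsubmx p 0 0.
Definition ycoord (R : realType) (k : nat) (p : 'rV[R]_(2 + k)) : R :=
  lsubmx p 0 1.
Definition zcoord (R : realType) (k : nat) (p : 'rV[R]_(2 + k)) : 'rV[R]_k :=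
  rsubmx p.

(* [0, e)^2 x V and (0, e)^2 x V *)
Definition corner (R : realType) (k : nat) (e : R) (V : set 'rV[R]_k) :
    set 'rV[R]_(2 + k) :=
  [set p | [/\ 0 <= xcoord p < e, 0 <= ycoord p < e & V (zcoord p)]].
Definition corner_int (R : realType) (k : nat) (e : R) (V : set 'rV[R]_k) :
    set 'rV[R]_(2 + k) :=
  [set p | [/\ 0 < xcoord p < e, 0 < ycoord p < e & V (zcoord p)]].

(* [iter_partial [:: i1; ...; im] f] is d_i1 (... (d_im f)). *)
Definition iter_partial (R : realType) (n : nat) (s : seq 'I_n)
    (f : 'rV[R]_n -> R) : 'rV[R]_n -> R :=
  foldr (fun i (h : 'rV[R]_n -> R) p => 'D_(delta_mx 0 i) h p) f s.

(* C^oo on an open set W: the iterated partial derivatives of all orders exist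
   and are continuous at every point of W. *)
Definition smooth_open (R : realType) (n : nat) (W : set 'rV[R]_n)
    (f : 'rV[R]_n -> R) : Prop :=
  forall (s : seq 'I_n) (p : 'rV[R]_n), W p ->
    {for p, continuous (iter_partial s f)} /\
    (forall i : 'I_n, derivable (iter_partial s f) p (delta_mx 0 i)).

(* Smoothness on a set that need not be open (here a manifold with corners):
   local extendability to a C^oo function on an open set. *)
Definition smooth_on (R : realType) (n : nat) (A : set 'rV[R]_n)
    (f : 'rV[R]_n -> R) : Prop :=
  forall p, A p -> exists (W : set 'rV[R]_n) (h : 'rV[R]_n -> R),
    [/\ open W, W p, smooth_open W h & forall q, W q -> A q -> h q = f q].

(* A metric is given by its Gram matrix in the standard coordinates;
   [quad_form G v] is G(v, v). *)
Definition quad_form (R : realType) (n : nat) (G : 'M[R]_n) (v : 'rV[R]_n) : R :=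
  (v *m G *m v^T) 0 0.

Definition riemannian_metric (R : realType) (n : nat) (A : set 'rV[R]_n)
    (g : 'rV[R]_n -> 'M[R]_n) : Prop :=
  [/\ forall i j : 'I_n, smooth_on A (fun p => g p i j),
      forall p, A p -> (g p)^T = g p &
      forall p, A p -> forall v, v != 0 -> 0 < quad_form (g p) v].

(* The Euclidean metric has the identity as Gram matrix. *)
Definition euclid_comparable (R : realType) (n : nat) (A : set 'rV[R]_n)
    (c0 C0 : R) (g : 'rV[R]_n -> 'M[R]_n) : Prop :=
  forall p, A p -> forall v,
    c0 * quad_form 1%:M v <= quad_form (g p) v <= C0 * quad_form 1%:M v.

(* Sequences are indexed from 0: [alpha j] and [c j] are the exponent and the
   weight of index j + 1 of the sequences (alpha_j), (c_j), j >= 1. *)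
Definition newton_data (R : realType) (alpha : nat -> R * R) (c : nat -> R) :
    Prop :=
  [/\ exists K : set (R * R),
        [/\ compact K, forall q, K q -> 0 <= q.1 /\ 0 <= q.2 &
            forall j, K (alpha j)],
      forall j, 0 < c j &
      cvgn (series c)].

Definition newton_term (R : realType) (k : nat) (alpha : nat -> R * R)
    (c : nat -> R) (p : 'rV[R]_(2 + k)) (j : nat) : R :=
  c j * xcoord p `^ (- (alpha j).1) * ycoord p `^ (- (alpha j).2).

(* F_N, the sum of the first N terms, and F, the sum of the series. *)
Definition newton_partial (R : realType) (k : nat) (alpha : nat -> R * R)
    (c : nat -> R) (N : nat) (p : 'rV[R]_(2 + k)) : R :=
  \sum_(0 <= j < N) newton_term alpha c p j.
Definition newton_sum (R : realType) (k : nat) (alpha : nat -> R * R)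
    (c : nat -> R) (p : 'rV[R]_(2 + k)) : R :=
  limn (series (newton_term alpha c p)).

Definition conformal (R : realType) (n : nat) (F : 'rV[R]_n -> R)
    (g : 'rV[R]_n -> 'M[R]_n) : 'rV[R]_n -> 'M[R]_n :=
  fun p => F p *: g p.

(* Absolute continuity on a set of parameters, for finite families of
   nonoverlapping intervals with endpoints in that set. *)
Definition abs_continuous_on (R : realType) (n : nat) (I : set R)
    (f : R -> 'rV[R]_n) : Prop :=
  forall e : R, 0 < e -> exists2 d : R, 0 < d &
    forall (m : nat) (s t : 'I_m -> R),
      (forall i, [/\ I (s i), I (t i) & s i <= t i]) ->
      (forall i j, i != j -> t i <= s j \/ t j <= s i) ->
      \sum_(i < m) (t i - s i) < d ->
      \sum_(i < m) `|f (t i) - f (s i)| < e.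

(* Curves are total functions; only their values on (a, b) matter. *)
Definition ac_curve (R : realType) (n : nat) (A : set 'rV[R]_n) (a b : R)
    (gamma : R -> 'rV[R]_n) : Prop :=
  [/\ a < b, forall t, a < t < b -> A (gamma t) &
      abs_continuous_on `]a, b[ gamma].

(* The length of gamma : (a, b) -> R^n. An absolutely continuous gamma is
   differentiable almost everywhere, so the arbitrary value of [derive1 gamma] at
   the other points is irrelevant. *)
Definition metric_length (R : realType) (n : nat) (g : 'rV[R]_n -> 'M[R]_n)
    (a b : R) (gamma : R -> 'rV[R]_n) : \bar R :=
  (\int[lebesgue_measure]_(t in `]a, b[)
     (Num.sqrt (quad_form (g (gamma t)) (derive1 gamma t)))%:E)%E.

(* Main.v *)
(* Along a curve the integrand of L_{g_N} is r_N times that of L_g, where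
   r_N = sqrt (F_N / F) is measurable, takes its values in [0, 1] and increases
   to 1. Monotone convergence gives the convergence of lengths, and
   L_{g_N} <= L_g gives the rest of (i) and (ii).

   For (iii) take the segment gamma(t) = (t, eps / 2, z0), 0 < t < b, with
   b = min(eps, 1), weights c_j = 4^-j and exponents alpha_j = (2 - 2 c_j, 0).
   Up to constants, the j-th term contributes the integral of
   sqrt(c_j) t^(c_j - 1), which is 2^j b^(c_j): each is finite, but they are
   unbounded in j, and each bounds the length for F from below. On (0, 1) the
   sum F_N is at most a multiple of t^(2 c_N - 2), whose square root is
   integrable. *)
Require Import Defs.
From mathcomp Require Import measurable_realfun ring lra.

Set Implicit Arguments.
Unset Strict Implicit.
Unset Printing Implicit Defensive.

Local Open Scope classical_set_scope.
Local Open Scope ring_scope.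

(** * Monotone convergence for integrands that may fail to be measurable *)

(* The integral of a nonnegative function is the supremum of the integrals of
   the simple functions below it, whether or not the function is measurable.
   Working with arbitrary integrands below spares a proof that the speed
   [derive1 gamma], defined as a limit that need not exist, is measurable. *)
Section lower_integral.
Context d (T : measurableType d) (R : realType).
Variables (mu : {measure set T -> \bar R}) (D : set T).
Import HBNNSimple.

Lemma ge0_le_lower_integral (f g : T -> R) :
  (forall x, D x -> 0 <= f x <= g x) ->
  (\int[mu]_(x in D) (f x)%:E <= \int[mu]_(x in D) (g x)%:E)%E.
Proof.
move=> fg; rewrite !ge0_integralE; last 2 first.
- by move=> x /fg /andP[f0 fg_x]; rewrite lee_fin (le_trans f0).
- by move=> x /fg /andP[f0 _]; rewrite lee_fin.
apply: le_ereal_sup => _ [h /= hf <-]; exists h => //= x.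
apply: le_trans (hf x) _; apply: lee_restrict => y /fg /andP[_ ?].
by rewrite lee_fin.
Qed.

(** The integrals increase, so they converge to their supremum, which is at most the integral of
    [f]. Conversely, for simple [h] below [f] the products [r n * h] are measurable, and their
    integrals tend to that of [h]. *)
Lemma cvg_lower_integral_scaled (r : nat -> T -> R) (f : T -> R) :
  measurable D ->
  (forall n, measurable_fun D (r n)) ->
  (forall x, D x -> 0 <= f x) ->
  (forall n x, D x -> 0 <= r n x <= 1) ->
  (forall x, D x -> nondecreasing_seq (r ^~ x)) ->
  (forall x, D x -> r ^~ x @ \oo --> (1 : R)) ->
  (\int[mu]_(x in D) (r n x * f x)%:E)%E @[n --> \oo]
    --> (\int[mu]_(x in D) (f x)%:E)%E.
Proof.
move=> mD mr f0 r01 ndr r1.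
pose I n := (\int[mu]_(x in D) (r n x * f x)%:E)%E.
have ndI : nondecreasing_seq I.
  move=> m n mn; apply: ge0_le_lower_integral => x Dx.
  by rewrite mulr_ge0 ?f0 ?ler_wpM2r ?f0 ?ndr//; case/andP: (r01 m x Dx).
have cI := ereal_nondecreasing_cvgn ndI.
suff -> : (\int[mu]_(x in D) (f x)%:E)%E = ereal_sup (range I) by exact: cI.
apply/eqP; rewrite eq_le; apply/andP; split; last first.
  apply: ge_ereal_sup => _ [n _ <-]; apply: ge0_le_lower_integral => x Dx.
  have /andP[r0 rle] := r01 n x Dx.
  by rewrite mulr_ge0 ?f0// ler_piMl ?f0.
rewrite {1}ge0_integralE; last by move=> x Dx; rewrite lee_fin f0.
(* Monotone convergence is applied to [r n * h], with [h <= f] simple. *)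
apply: ge_ereal_sup => _ [h /= hf <-].
have hD x : D x -> h x <= f x.
  by move=> Dx; move: (hf x); rewrite patchE mem_set// lee_fin.
(* Outside [D] the restriction of [f] is 0, so the nonnegative [h] vanishes there. *)
have <- : (\int[mu]_(x in D) (h x)%:E)%E = sintegral mu h.
  rewrite integral_nnsfun//; congr (sintegral mu _); apply/funext => x.
  rewrite patchE; case: ifPn => // /negP xD; apply/eqP; rewrite eq_le fun_ge0 /=.
  by move: (hf x); rewrite patchE (negbTE (introN idP xD)) lee_fin.
have cvgh : (\int[mu]_(x in D) (r n x * h x)%:E)%E @[n --> \oo]
    --> (\int[mu]_(x in D) (h x)%:E)%E.
  rewrite (eq_integral (fun x => limn (fun n => (r n x * h x)%:E))); last first.
    move=> x /set_mem Dx; apply/esym/cvg_lim => //; apply/fine_cvgP.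
    split; first exact: nearW.
    rewrite -[in X in _ --> X](mul1r (h x)); apply: cvgM; [exact: r1|exact: cvg_cst].
  apply: cvg_monotone_convergence => //.
  - move=> n; apply/measurable_EFinP/measurable_funM => //.
    exact: measurable_funTS.
  - by move=> n x Dx; rewrite lee_fin mulr_ge0//; case/andP: (r01 n x Dx).
  - by move=> x Dx m n mn; rewrite lee_fin ler_wpM2r//; exact: ndr.
rewrite -(cvg_lim _ cvgh)//; apply: lime_le.
  by apply/cvg_ex; eexists; exact: cvgh.
near=> n; apply: le_trans (ereal_sup_ubound _); last by exists n.
apply: ge0_le_lower_integral => x Dx; have /andP[rn0 _] := r01 n x Dx.
by rewrite mulr_ge0//= ler_wpM2l// hD.
Unshelve. all: by end_near. Qed.
End lower_integral.

(** * The integral of a power over (0, b) *)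

(** The integrand may blow up at 0, so the fundamental theorem of calculus is applied on []s n, b[]
    with [s n] tending to 0. The indicators of these intervals serve as the increasing factors of
    [cvg_lower_integral_scaled]. *)
Lemma integral_power (R : realType) (b delta : R) : 0 < b -> 0 < delta ->
  (\int[lebesgue_measure]_(t in `]0%R, b[) (t `^ (delta - 1))%:E)%E
  = (b `^ delta / delta)%:E.
Proof.
(* With [n.+2] rather than [n.+1], already [s 0 < b]. *)
move=> b0 d0; pose s (n : nat) : R := b * n.+2%:R^-1.
have s0 n : 0 < s n by rewrite mulr_gt0 ?invr_gt0.
have sb n : s n < b by rewrite gtr_pMr// invf_lt1// ltr1n.
pose A n : set R := `]s n, b[%classic.
have AD n : A n `<=` `]0, b[%classic.
  by move=> x; rewrite /A /= !in_itv /= => /andP[sx ->]; rewrite (lt_trans (s0 n)).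
have s_cvg : s @ \oo --> (0 : R).
  rewrite -(mulr0 b); apply: cvgM; first exact: cvg_cst.
  have := @cvg_harmonic R; rewrite -(cvg_shiftn 1); apply: cvg_trans.
  by apply: near_eq_cvg; near=> n; rewrite /= addn1.
have intA n : (\int[lebesgue_measure]_(t in `]0%R, b[)
    (\1_(A n) t * t `^ (delta - 1))%:E)%E
    = (b `^ delta / delta - s n `^ delta / delta)%:E.
  have -> : (fun t => (\1_(A n) t * t `^ (delta - 1))%:E)
      = (fun t => (t `^ (delta - 1))%:E) \_ (A n).
    apply/funext => t; rewrite patchE indicE.
    by case: (t \in A n); rewrite ?mul1r ?mul0r.
  rewrite -integral_mkcondr setIidr//.
  have dpow x : 0 < x -> forall a : R, derivable (@powR R ^~ a) x 1.
    by move=> x0 a; apply: derivable_powR; rewrite in_itv /= x0.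
  have cpow x : 0 < x -> forall a : R, {for x, continuous (@powR R ^~ a)}.
    move=> x0 a; apply/differentiable_continuous/derivable1_diffP; exact: dpow.
  (* Adding the two endpoints, a null set, gives the closed interval of [continuous_FTC2]. *)
  rewrite -(@integral_itv_bndoo _ _ _ _ true false); last first.
    apply/measurable_EFinP; apply: measurable_funTS; exact: measurable_powR.
  rewrite EFinB.
  apply: (@continuous_FTC2 _ _ (fun x => x `^ delta / delta)) => //.
  - apply: derivable_within_continuous => x; rewrite in_itv /= => /andP[sx _].
    by apply: dpow; exact: lt_le_trans sx.
  - split.
    + move=> x; rewrite in_itv /= => /andP[sx _].
      by apply: derivableM => //; apply: dpow; exact: lt_trans sx.
    + apply: cvgM; last exact: cvg_cst.
      by apply: cvg_at_right_filter; exact: cpow.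
    + apply: cvgM; last exact: cvg_cst.
      by apply: cvg_at_left_filter; exact: cpow.
  - move=> x; rewrite in_itv /= => /andP[sx _].
    have x0 : 0 < x by exact: lt_trans sx.
    rewrite derive1E deriveM//; last exact: dpow.
    rewrite derive_cst scaler0 add0r -derive1E powR_derive1 ?in_itv/= ?x0//.
    by rewrite /GRing.scale /= mulrA mulVf ?mul1r ?gt_eqF.
have r1 x : `]0, b[%classic x -> (fun n => \1_(A n) x : R) @ \oo --> (1 : R).
  rewrite /= in_itv /= => /andP[x0 xb].
  apply: cvg_near_cst; near=> n; rewrite indicE mem_set// /A /= in_itv /= xb andbT.
  near: n; move/cvgrPdist_lt : s_cvg => /(_ _ x0); apply: filterS => n.
  by rewrite sub0r normrN gtr0_norm.
have /(_ _ _ _ _ r1) H := @cvg_lower_integral_scaled _ _ R lebesgue_measure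
  `]0, b[%classic (fun n x => \1_(A n) x) (fun t => t `^ (delta - 1))
  (measurable_itv _).
rewrite -(cvg_lim _ (H _ _ _ _))//.
- under eq_fun do rewrite intA.
  apply/cvg_lim => //; apply/fine_cvgP; split; first exact: nearW.
  rewrite -[X in _ --> X]subr0; apply: cvgB; first exact: cvg_cst.
  rewrite -(mul0r delta^-1); apply: cvgM; last exact: cvg_cst.
  by move/cvg_at_rightP : (powR_cvg0 d0); apply.
- by move=> n; apply: measurable_funTS; apply: measurable_indic; exact: measurable_itv.
- by move=> x _; exact: powR_ge0.
- by move=> n x _; rewrite indicE; case: (_ \in _); rewrite /= ?lexx ?ler01.
- move=> x xD m n mn; rewrite !indicE ler_nat.
  have [xA|] := boolP (x \in A m); last by [].
  rewrite mem_set//; move: xA => /set_mem; rewrite /A /= !in_itv /= => /andP[sx ->].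
  rewrite andbT (le_lt_trans _ sx)// ler_pM2l// lef_pV2 ?posrE// ler_nat.
  by rewrite !ltnS.
Unshelve. all: by end_near. Qed.

(** * Absolutely continuous and affine curves *)

Section curves.
Context (R : realType) (n : nat).
Implicit Types (gamma : R -> 'rV[R]_n) (a b t : R).

(** Absolute continuity for families of a single interval is uniform continuity, and continuity on
    an open interval gives measurability. *)
Lemma measurable_abs_continuous_coord a b gamma (i : 'I_n) :
  abs_continuous_on `]a, b[ gamma ->
  measurable_fun `]a, b[ (fun t => gamma t 0 i).
Proof.
move=> ac; apply: open_continuous_measurable_fun; first exact: interval_open.
move=> t /set_mem /=; rewrite in_itv /= => tab.
apply/cvgrPdist_lt => e e0; have [d d0 H] := ac e e0.
have tI : `]a, b[%classic t by rewrite /= in_itv.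
near=> s.
have sI : `]a, b[%classic s.
  by near: s; apply: (@near_in_itvoo _ a b t); rewrite in_itv.
have std : `|t - s| < d by near: s; apply: cvgr_dist_lt.
have := H 1%N (fun=> Num.min s t) (fun=> Num.max s t).
rewrite !big_ord1 => {}H.
apply: le_lt_trans (H _ _ _).
- rewrite (_ : `|gamma (Num.max s t) - _| = `|gamma t - gamma s|); last first.
    by case: (leP s t) => // _; rewrite distrC.
  have -> : gamma t 0 i - gamma s 0 i = (gamma t - gamma s) 0 i by rewrite !mxE.
  rewrite [leRHS]/Num.norm /= mx_normrE.
  exact: (le_bigmax _ (fun ij => `|(gamma t - gamma s) ij.1 ij.2|) (0, i)).
- move=> _; split.
  + by case: (leP s t).
  + by case: (leP s t).
  + by rewrite ge_min !le_max lexx.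
- by move=> j1 j2; rewrite !ord1 eqxx.
- case: (leP s t) std => st; first by rewrite ger0_norm ?subr_ge0.
  by rewrite distrC ger0_norm// subr_ge0 ltW.
Unshelve. all: by end_near. Qed.

Lemma abs_continuous_on_affine (I : set R) (u p : 'rV[R]_n) :
  abs_continuous_on I (fun t => t *: u + p).
Proof.
(* The increments are [(t i - s i) *: u]; the summand 1 keeps the denominator positive when
   [u = 0]. *)
move=> e e0; exists (e / (1 + `|u|)); first by rewrite divr_gt0// ltr_wpDr.
move=> m s t st _; rewrite ltr_pdivlMr ?ltr_wpDr// => H.
apply: le_lt_trans H; rewrite mulr_suml; apply: ler_sum => i _.
have [_ _ sti] := st i.
rewrite opprD addrACA subrr addr0 -scalerBl normrZ ger0_norm ?subr_ge0//.
by rewrite ler_wpM2l ?subr_ge0// lerDr.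
Qed.

Lemma derive1_affine (u p : 'rV[R]_n) t : derive1 (fun t => t *: u + p) t = u.
Proof.
apply/cvg_lim => //; apply: cvg_near_cst; near=> h.
have h0 : h != 0 by near: h; exact: nbhs_dnbhs_neq.
by rewrite opprD addrACA subrr addr0 -scalerBl addrK scalerA mulVf// scale1r.
Unshelve. all: by end_near. Qed.

End curves.

(** * Convergence, bounds and measurability of Newton sums *)

Section newton.
Context (R : realType) (k : nat).
Implicit Types (alpha : nat -> R * R) (c : nat -> R) (p : 'rV[R]_(2 + k)).

Lemma newton_term_gt0 alpha c p j : newton_data alpha c ->
  0 < xcoord p -> 0 < ycoord p -> 0 < newton_term alpha c p j.
Proof. by move=> [_ c0 _] x0 y0; rewrite !mulr_gt0 ?powR_gt0. Qed.

Lemma newton_partial_nondecreasing alpha c p : newton_data alpha c ->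
  0 < xcoord p -> 0 < ycoord p ->
  nondecreasing_seq (fun N => newton_partial alpha c N p).
Proof.
move=> nd x0 y0; apply/nondecreasing_seqP => N.
by rewrite /newton_partial big_nat_recr//= lerDl ltW// newton_term_gt0.
Qed.

(** A bound uniform in the exponent [a]; the absolute value of [ln x] treats [x < 1] and [x > 1]
    together. *)
Lemma powRN_le_expR (x a A : R) : 0 < x -> 0 <= a <= A ->
  x `^ (- a) <= expR (A * `|ln x|).
Proof.
move=> x0 /andP[a0 aA]; rewrite /powR gt_eqF// ler_expR.
apply: (@le_trans _ _ (a * `|ln x|)); last by rewrite ler_wpM2r.
by rewrite mulNr -mulrN ler_wpM2l// -normrN ler_norm.
Qed.

(** Compactness bounds all exponents by one constant, so at a fixed [p] the terms are at most
    [c j * B] with [B] independent of [j]; comparison with the series of weights concludes. *)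
Lemma cvg_newton_partial alpha c p : newton_data alpha c ->
  0 < xcoord p -> 0 < ycoord p ->
  (fun N => newton_partial alpha c N p) @ \oo --> newton_sum alpha c p.
Proof.
move=> nd x0 y0; have [[K [cK K0 aK]] c0 cc] := nd.
have [M MK] : exists M : R, forall q, K q -> `|q| <= M.
  have [M [_ HM]] := compact_bounded cK; exists (M + 1) => q Kq.
  by apply: (HM (M + 1)) => //; rewrite ltrDl.
pose B := expR (M * `|ln (xcoord p)|) * expR (M * `|ln (ycoord p)|).
suff : cvgn (series (newton_term alpha c p)) by [].
apply: (@series_le_cvg _ _ (fun j => c j * B)).
- by move=> j; apply/ltW/newton_term_gt0.
- by move=> j; rewrite !mulr_ge0 ?expR_ge0// ltW.
- move=> j; rewrite /newton_term -mulrA ler_wpM2l ?(ltW (c0 j))//.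
  have [a1 a2] := K0 _ (aK j); have := MK _ (aK j).
  rewrite prod_normE ge_max => /andP[a1M a2M].
  apply: ler_pM; rewrite ?powR_ge0//; apply: powRN_le_expR => //.
  + by rewrite a1 (le_trans _ a1M)// ler_norm.
  + by rewrite a2 (le_trans _ a2M)// ler_norm.
- rewrite (_ : series _ = (fun N => series c N * B)); last first.
    by apply/funext => N; rewrite /series /= mulr_suml.
  by apply: is_cvgMl => //; exact: is_cvg_cst.
Qed.

Lemma newton_partial_le_sum alpha c p N : newton_data alpha c ->
  0 < xcoord p -> 0 < ycoord p ->
  newton_partial alpha c N p <= newton_sum alpha c p.
Proof.
move=> nd x0 y0; have H := cvg_newton_partial nd x0 y0.
rewrite -(cvg_lim _ H)//; apply: nondecreasing_cvgn_le.
  exact: newton_partial_nondecreasing.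
by apply/cvg_ex; eexists; exact: H.
Qed.

(** Index 0 gives positivity of the sum; arbitrary [j] gives the lower bounds on length in (iii). *)
Lemma newton_term_le_sum alpha c p j : newton_data alpha c ->
  0 < xcoord p -> 0 < ycoord p ->
  newton_term alpha c p j <= newton_sum alpha c p.
Proof.
move=> nd x0 y0; apply: le_trans (newton_partial_le_sum j.+1 nd x0 y0).
rewrite /newton_partial big_nat_recr//= lerDr sumr_ge0// => i _.
exact/ltW/newton_term_gt0.
Qed.

Lemma newton_sum_gt0 alpha c p : newton_data alpha c ->
  0 < xcoord p -> 0 < ycoord p -> 0 < newton_sum alpha c p.
Proof.
move=> nd x0 y0; apply: lt_le_trans (newton_term_le_sum 0 nd x0 y0).
exact: newton_term_gt0.
Qed.

Lemma newton_partial_ge0 alpha c p N : newton_data alpha c ->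
  0 < xcoord p -> 0 < ycoord p -> 0 <= newton_partial alpha c N p.
Proof.
by move=> nd x0 y0; apply: sumr_ge0 => j _; exact/ltW/newton_term_gt0.
Qed.

Lemma measurable_newton_partial alpha c N (D : set R)
    (gamma : R -> 'rV[R]_(2 + k)) :
  measurable_fun D (fun t => xcoord (gamma t)) ->
  measurable_fun D (fun t => ycoord (gamma t)) ->
  measurable_fun D (fun t => newton_partial alpha c N (gamma t)).
Proof.
move=> mx my; apply: measurable_sum => j.
apply: measurable_funM; first apply: measurable_funM; first exact: measurable_cst.
- by apply: (measurableT_comp (measurable_powR _) mx).
- by apply: (measurableT_comp (measurable_powR _) my).
Qed.

End newton.

(** * Comparison and convergence of the lengths *)

Section length.
Context (R : realType) (k : nat).
Variables (V : set 'rV[R]_k) (eps : R).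
Variables (g0 : 'rV[R]_(2 + k) -> 'M[R]_(2 + k)) (c0 C0 : R).
Hypothesis hc0 : 0 < c0.
Hypothesis hcmp : euclid_comparable (corner eps V) c0 C0 g0.

Lemma quad_form_id_ge0 n (v : 'rV[R]_n) : 0 <= quad_form 1%:M v.
Proof.
by rewrite /quad_form mulmx1 mxE sumr_ge0// => i _; rewrite mxE -expr2 sqr_ge0.
Qed.

Lemma quad_form_conformal n (F : 'rV[R]_n -> R) (g : 'rV[R]_n -> 'M[R]_n) p v :
  quad_form (conformal F g p) v = F p * quad_form (g p) v.
Proof. by rewrite /quad_form /conformal -scalemxAr -scalemxAl mxE. Qed.

Lemma corner_int_sub : corner_int eps V `<=` corner eps V.
Proof.
by move=> p [/andP[x0 xe] /andP[y0 ye] Vz]; split => //; rewrite ltW.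
Qed.

Lemma quad_form_ge0 p v : corner_int eps V p -> 0 <= quad_form (g0 p) v.
Proof.
move=> /corner_int_sub/hcmp/(_ v)/andP[+ _]; apply: le_trans.
by rewrite mulr_ge0 ?quad_form_id_ge0// ltW.
Qed.

Lemma metric_length_newton_partial_le alpha c N a b gamma :
  newton_data alpha c -> ac_curve (corner_int eps V) a b gamma ->
  (metric_length (conformal (newton_partial alpha c N) g0) a b gamma
   <= metric_length (conformal (newton_sum alpha c) g0) a b gamma)%E.
Proof.
move=> nd [_ inU _]; apply: ge0_le_lower_integral => t; rewrite /= in_itv /=.
move=> /inU gU; have [/andP[x0 _] /andP[y0 _] _] := gU.
rewrite sqrtr_ge0 /= ler_wsqrtr// !quad_form_conformal.
by rewrite ler_wpM2r ?quad_form_ge0// newton_partial_le_sum.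
Qed.

(** The limit is taken in the extended reals, so an infinite limiting length is covered too. *)
Lemma cvg_metric_length_newton_partial alpha c a b gamma :
  newton_data alpha c -> ac_curve (corner_int eps V) a b gamma ->
  metric_length (conformal (newton_partial alpha c N) g0) a b gamma
    @[N --> \oo]
  --> metric_length (conformal (newton_sum alpha c) g0) a b gamma.
Proof.
move=> nd [_ inU ac].
pose F t := newton_sum alpha c (gamma t).
pose FN N t := newton_partial alpha c N (gamma t).
have U t : `]a, b[%classic t -> corner_int eps V (gamma t).
  by rewrite /= in_itv /=; exact: inU.
have x0 t : `]a, b[%classic t -> 0 < xcoord (gamma t) by move=> /U[/andP[]].
have y0 t : `]a, b[%classic t -> 0 < ycoord (gamma t) by move=> /U[_ /andP[]].
have F0 t : `]a, b[%classic t -> 0 < F t.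
  by move=> tab; apply: newton_sum_gt0; auto.
have mFN N : measurable_fun `]a, b[ (FN N).
  have mcoord i := measurable_abs_continuous_coord i ac.
  apply: measurable_newton_partial; apply: eq_measurable_fun (mcoord (lshift k _)).
  - by move=> t _; rewrite /xcoord mxE.
  - by move=> t _; rewrite /ycoord mxE.
have mF : measurable_fun `]a, b[ F.
  apply: (measurable_fun_cvg mFN) => t tab.
  by apply: cvg_newton_partial; auto.
pose r N t := Num.sqrt (FN N t / F t).
rewrite /metric_length.
have E N : (\int[lebesgue_measure]_(t in `]a, b[) (Num.sqrt (quad_form
      (conformal (newton_partial alpha c N) g0 (gamma t)) (derive1 gamma t)))%:E
  = \int[lebesgue_measure]_(t in `]a, b[) (r N t * Num.sqrt (quad_form
      (conformal (newton_sum alpha c) g0 (gamma t)) (derive1 gamma t)))%:E)%E.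
  apply: eq_integral => t /set_mem tab; congr EFin.
  rewrite !quad_form_conformal -sqrtrM; last first.
    by rewrite divr_ge0 ?(ltW (F0 t tab))// newton_partial_ge0; auto.
  by rewrite mulrA divfK ?gt_eqF ?F0.
under eq_fun do rewrite E.
apply: cvg_lower_integral_scaled.
- exact: measurable_itv.
- move=> N; apply: (measurableT_comp (continuous_measurable_fun _)).
    exact: sqrt_continuous.
  apply: measurable_funM; first exact: mFN.
  (* As [F > 0], its inverse is a real power, and [powR] is measurable. *)
  apply: (eq_measurable_fun (fun t => F t `^ (- 1))).
    by move=> t /set_mem tab; rewrite powR_inv1 ?(ltW (F0 t tab)).
  exact: (measurableT_comp (measurable_powR _) mF).
- by move=> t _; exact: sqrtr_ge0.
- move=> N t tab; rewrite sqrtr_ge0 /= -sqrtr1 ler_wsqrtr//.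
  by rewrite ler_pdivrMr ?F0// mul1r newton_partial_le_sum; auto.
- move=> t tab m n mn; rewrite ler_wsqrtr// ler_wpM2r//.
    by rewrite invr_ge0 ltW ?F0.
  have := newton_partial_nondecreasing nd (x0 t tab) (y0 t tab); exact.
- move=> t tab; rewrite -[X in _ --> X]sqrtr1.
  apply: continuous_cvg; first exact: sqrt_continuous.
  rewrite -(mulfV (lt0r_neq0 (F0 t tab))); apply: cvgM; last exact: cvg_cst.
  by apply: cvg_newton_partial; auto.
Qed.

End length.

(** * A segment of infinite length whose truncated lengths are finite *)

Section infinite_length.
Context (R : realType) (k : nat).
Variables (V : set 'rV[R]_k) (eps : R) (z0 : 'rV[R]_k).
Variables (g0 : 'rV[R]_(2 + k) -> 'M[R]_(2 + k)) (c0 C0 : R).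
Hypotheses (heps : 0 < eps) (hc0 : 0 < c0) (Vz0 : V z0).
Hypothesis hcmp : euclid_comparable (corner eps V) c0 C0 g0.

(** The exponents tend to the critical value 2, where the square root 1/t is no longer integrable at
    0. Powers of 4 make [sqrt (c j) / c j] equal to [2 ^+ j]. *)
Definition quarter_weight (j : nat) : R := 4^-1 ^+ j.
Definition quarter_exponent (j : nat) : R * R := (2 - 2 * quarter_weight j, 0).

Definition x_direction : 'rV[R]_(2 + k) := row_mx (delta_mx 0 0) 0.
Definition x_segment (t : R) : 'rV[R]_(2 + k) :=
  t *: x_direction + row_mx ((eps / 2) *: delta_mx 0 1) z0.

Local Notation c := quarter_weight.
Local Notation alpha := quarter_exponent.
(** [t < eps] keeps the segment in the corner; [t < 1] makes powers of [t] decrease in the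
    exponent. *)
Local Notation b := (Num.min eps 1).

Let b0 : 0 < b. Proof. by rewrite lt_min heps ltr01. Qed.

Lemma quarter_weight_gt0 j : 0 < c j.
Proof. by rewrite exprn_gt0// invr_gt0. Qed.

Lemma quarter_weight_nonincreasing i j : (i <= j)%N -> c j <= c i.
Proof. by apply: ler_wiXn2l; rewrite ?invr_ge0// invf_le1// ler1n. Qed.

Lemma quarter_weight_le1 j : c j <= 1.
Proof. exact: (@quarter_weight_nonincreasing 0 j). Qed.

Lemma quarter_newton_data : newton_data alpha c.
Proof.
split; last 2 first.
- exact: quarter_weight_gt0.
- have := @is_cvg_geometric_series R 1 4^-1.
  rewrite (_ : geometric 1 _ = c); last first.
    by apply/funext => j; rewrite /= mul1r.
  by apply; rewrite ger0_norm ?invr_ge0// invf_lt1// ltr1n.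
exists (`[0, 2]%classic `*` [set 0]); split.
- by apply: compact_setX; [exact: segment_compact|exact: compact_set1].
- by move=> q [/= + ->]; rewrite in_itv /= => /andP[].
- move=> j; split => //=; rewrite in_itv /=.
  have := quarter_weight_gt0 j; have := quarter_weight_le1 j; lra.
Qed.

Lemma x_segment_coords t :
  [/\ xcoord (x_segment t) = t, ycoord (x_segment t) = eps / 2 &
      zcoord (x_segment t) = z0].
Proof.
rewrite /xcoord /ycoord /zcoord /x_segment /x_direction.
rewrite scale_row_mx add_row_mx row_mxKl row_mxKr scaler0 add0r.
by rewrite !mxE /= !mulr1 !mulr0 addr0 add0r.
Qed.

Lemma x_segment_corner_int t : 0 < t < b -> corner_int eps V (x_segment t).
Proof.
rewrite lt_min => /and3P[t0 te _].
have [xt yt zt] := x_segment_coords t; split; rewrite ?xt ?yt ?zt ?t0 ?te//.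
by move: heps; lra.
Qed.

Lemma ac_x_segment : ac_curve (corner_int eps V) 0 b x_segment.
Proof.
split; [exact: b0|exact: x_segment_corner_int|exact: abs_continuous_on_affine].
Qed.

Lemma quad_form_x_direction : quad_form 1%:M x_direction = 1.
Proof.
rewrite /quad_form mulmx1 /x_direction tr_row_mx mul_row_col trmx0 mulmx0 addr0.
by rewrite trmx_delta mul_delta_mx mxE !eqxx.
Qed.

Lemma x_segment_quad_form t : 0 < t < b ->
  c0 <= quad_form (g0 (x_segment t)) x_direction <= C0.
Proof.
move=> /x_segment_corner_int/corner_int_sub/hcmp/(_ x_direction).
by rewrite quad_form_x_direction !mulr1.
Qed.

(** The power appears as a square so that the speed contains exactly [t ^ (c j - 1)]. *)
Lemma x_segment_newton_term t j :
  newton_term alpha c (x_segment t) j = c j * (t `^ (c j - 1)) ^+ 2.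
Proof.
have [xt yt _] := x_segment_coords t.
rewrite /newton_term xt yt /= oppr0 powRr0 mulr1; congr (_ * _).
rewrite -powR_mulrn ?powR_ge0// -powRrM; congr (_ `^ _); ring.
Qed.

(** For [j < N] one has [c N <= c j], and on (0, 1) the smaller exponent gives the larger power. *)
Lemma x_segment_newton_partial_le t N : 0 < t < b ->
  newton_partial alpha c N (x_segment t)
  <= series c N * (t `^ (c N - 1)) ^+ 2.
Proof.
rewrite lt_min => /and3P[t0 _ t1].
rewrite /newton_partial /series /= mulr_suml !big_mkord; apply: ler_sum => j _.
rewrite x_segment_newton_term ler_wpM2l ?(ltW (quarter_weight_gt0 _))//.
rewrite lerXn2r ?nnegrE ?powR_ge0// ger_powR ?t0 ?(ltW t1)//.
by rewrite lerB// quarter_weight_nonincreasing// ltnW.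
Qed.

Lemma x_segment_length_newton_partial N :
  (metric_length (conformal (newton_partial alpha c N) g0) 0 b x_segment
   < +oo)%E.
Proof.
pose K := Num.sqrt (C0 * series c N).
apply: (@le_lt_trans _ _
  (\int[lebesgue_measure]_(t in `]0%R, b[) (K * t `^ (c N - 1))%:E)%E).
  apply: ge0_le_lower_integral => t; rewrite /= in_itv /= => tb.
  have [q0 q1] := andP (x_segment_quad_form tb).
  have [/andP[x0 _] /andP[y0 _] _] := x_segment_corner_int tb.
  rewrite sqrtr_ge0 /= derive1_affine quad_form_conformal.
  (* The bound is put under a single square root, so that only the radicands are compared. *)
  rewrite -(@ger0_norm _ (t `^ _)) ?powR_ge0// -sqrtr_sqr -sqrtrM; last first.
    apply: mulr_ge0; first exact: le_trans (ltW hc0) (le_trans q0 q1).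
    by apply: sumr_ge0 => j _; exact/ltW/quarter_weight_gt0.
  rewrite ler_wsqrtr// -mulrA [leRHS]mulrC; apply: ler_pM => //.
  - exact: newton_partial_ge0 quarter_newton_data _ _.
  - exact: le_trans (ltW hc0) q0.
  - exact: x_segment_newton_partial_le.
under eq_integral do rewrite EFinM.
rewrite ge0_integralZl//.
- by rewrite integral_power ?quarter_weight_gt0// -EFinM ltry.
- apply/measurable_EFinP; apply: measurable_funTS; exact: measurable_powR.
- by move=> t _; rewrite lee_fin powR_ge0.
- by rewrite lee_fin sqrtr_ge0.
Qed.

Lemma x_segment_length_newton_sum :
  metric_length (conformal (newton_sum alpha c) g0) 0 b x_segment = +oo%E.
Proof.
pose L := metric_length (conformal (newton_sum alpha c) g0) 0 b x_segment.
(* The [j]-th lower bound is [sqrt c0 * b ^ (c j) * 2 ^+ j]; since [b <= 1] and [c j <= 1],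
   replacing [b ^ (c j)] by [b] makes the constant independent of [j]. *)
pose K := Num.sqrt c0 * b.
have K0 : 0 < K by rewrite mulr_gt0 ?sqrtr_gt0.
have nd := quarter_newton_data.
have LK j : ((K * 2 ^+ j)%:E <= L)%E.
  pose s := Num.sqrt (c0 * c j).
  (* The middle integral keeps only the [j]-th Newton term and the lower bound [c0] of the
     metric. *)
  apply: (@le_trans _ _
    (\int[lebesgue_measure]_(t in `]0%R, b[) (s * t `^ (c j - 1))%:E)%E).
    under eq_integral do rewrite EFinM.
    rewrite ge0_integralZl//; last 3 first.
    - apply/measurable_EFinP; apply: measurable_funTS; exact: measurable_powR.
    - by move=> t _; rewrite lee_fin powR_ge0.
    - by rewrite lee_fin sqrtr_ge0.
    rewrite integral_power ?quarter_weight_gt0// -EFinM lee_fin.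
    have -> : s = Num.sqrt c0 * (2^-1) ^+ j.
      rewrite /s sqrtrM ?(ltW hc0)//; congr (_ * _).
      rewrite -[RHS]ger0_norm ?exprn_ge0 ?invr_ge0// -sqrtr_sqr -exprAC.
      by congr (Num.sqrt (_ ^+ _)); field.
    rewrite /K -!mulrA ler_wpM2l ?sqrtr_ge0// mulrCA.
    have -> : (2^-1) ^+ j / c j = 2 ^+ j :> R.
      by rewrite /c -exprVn invrK -exprMn; congr (_ ^+ _); field.
    rewrite ler_wpM2r ?exprn_ge0// ger1_powR ?quarter_weight_le1//.
    by rewrite b0 ge_min lexx orbT.
  apply: ge0_le_lower_integral => t; rewrite /= in_itv /= => tb.
  have [q0 q1] := andP (x_segment_quad_form tb).
  have [/andP[x0 _] /andP[y0 _] _] := x_segment_corner_int tb.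
  rewrite mulr_ge0 ?sqrtr_ge0 ?powR_ge0//= derive1_affine quad_form_conformal.
  rewrite -(@ger0_norm _ (t `^ _)) ?powR_ge0// -sqrtr_sqr -sqrtrM; last first.
    by rewrite mulr_ge0 ?ltW ?quarter_weight_gt0.
  rewrite ler_wsqrtr// -mulrA mulrC; apply: ler_pM => //.
  - by rewrite mulr_ge0 ?sqr_ge0// ltW ?quarter_weight_gt0.
  - exact: ltW.
  - by rewrite -x_segment_newton_term newton_term_le_sum.
apply/eqyP => r r0.
(* By the Archimedean property [r / K < j], and [j < 2 ^ j]. *)
pose j := Num.bound (r / K).
apply: le_trans (LK j); rewrite lee_fin mulrC -ler_pdivrMr//.
apply: (@le_trans _ _ j%:R); first by rewrite ltW// archi_boundP// divr_ge0// ltW.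
by rewrite -natrX ler_nat ltnW// ltn_expl.
Qed.

End infinite_length.

Theorem corollary8p3 (R : realType) (k : nat) (V : set 'rV[R]_k) (eps : R)
    (g0 : 'rV[R]_(2 + k) -> 'M[R]_(2 + k)) (c0 C0 : R)
    (hV : open V) (heps : 0 < eps)
    (hg0 : riemannian_metric (corner eps V) g0)
    (hc0 : 0 < c0) (hC0 : c0 <= C0)
    (hcmp : euclid_comparable (corner eps V) c0 C0 g0) :
  let L alpha c := metric_length (conformal (newton_sum alpha c) g0) in
  let LN alpha c N := metric_length (conformal (newton_partial alpha c N) g0) in
  (forall (alpha : nat -> R * R) (c : nat -> R), newton_data alpha c ->
   forall (a b : R) (gamma : R -> 'rV[R]_(2 + k)),
   ac_curve (corner_int eps V) a b gamma ->
     ((L alpha c a b gamma < +oo)%E ->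
        (forall N : nat, (LN alpha c N a b gamma < +oo)%E) /\
        LN alpha c N a b gamma @[N --> \oo] --> L alpha c a b gamma)
     /\
     ((exists N : nat, LN alpha c N a b gamma = +oo%E) ->
        L alpha c a b gamma = +oo%E))
  /\
  (V !=set0 ->
   exists (alpha : nat -> R * R) (c : nat -> R), newton_data alpha c /\
   exists (a b : R) (gamma : R -> 'rV[R]_(2 + k)),
   [/\ ac_curve (corner_int eps V) a b gamma,
       forall N : nat, (LN alpha c N a b gamma < +oo)%E &
       L alpha c a b gamma = +oo%E]).
Proof.
move=> L LN; split.
  move=> alpha c nd a b gamma ac.
  (* This one inequality gives both the finiteness in (i) and claim (ii). *)
  have le N := metric_length_newton_partial_le hc0 hcmp N nd ac.
  split=> [Lfin|[N LNoo]].
    split; last exact: (cvg_metric_length_newton_partial nd ac).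
    by move=> N; apply: le_lt_trans (le N) Lfin.
  by apply/eqP; rewrite -leye_eq -LNoo; exact: le.
move=> [z0 Vz0]; exists (@quarter_exponent R), (@quarter_weight R).
split; first exact: quarter_newton_data.
exists 0, (Num.min eps 1), (x_segment eps z0); split.
- exact: ac_x_segment.
- exact: x_segment_length_newton_partial Vz0 hcmp.
- exact: x_segment_length_newton_sum Vz0 hcmp.
Qed.
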